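(* Let $m\ge 1$ be an integer and let $x\in[0,1]$ be fixed. The optimization problem $$\min\Big\{\|w\|_{L^2}^2 \colon w\in L^2([0,1]),\ \int_0^1 z^{\ell}w(z)\,dz=x^{\ell},\ \ell=0,1,\dots,m-1\Big\}$$ has the unique solution $$w_m^x(z)=\sum_{i=1}^m\alpha_{x,i}\,z^{i-1},\qquad z\in(0,1),$$ where the vector $\alpha_x=(\alpha_{x,1},\dots,\alpha_{x,m})$ satisfies the linear equations $H_m\alpha_x=\bar x$ with the Hilbert matrix $H_m=\big(\tfrac{1}{i+j-1}\big)_{i,j=1}^{m}$ and the vector $\bar x=(1,x,\dots,x^{m-1})\in\mathbb{R}^m$.
   Context: $L^2([0,1])$ is taken with respect to Lebesgue (uniform) measure, $\|w\|_{L^2}^2=\int_0^1 w(z)^2\,dz$, and elements are identified up to almost everywhere equality. The convention $0^0=1$ is used. *)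

(* Defs.v *)
From HB Require Import structures.
From mathcomp Require Import all_boot all_order all_algebra.
From mathcomp Require Import all_classical all_reals all_analysis.
Set Implicit Arguments.
Unset Strict Implicit.
Unset Printing Implicit Defensive.
Import Order.TTheory GRing.Theory Num.Theory.
Import numFieldNormedType.Exports.
Local Open Scope classical_set_scope.
Local Open Scope ring_scope.

(* L^2([0,1]): the library's space of classes of measurable functions modulo
   almost everywhere equality, for Lebesgue measure on [0,1], i.e. the uniform
   probability of density 1 on [0,1] with respect to Lebesgue measure on R.
   An element coerces to a function through a chosen representative; the
   integrals below do not depend on that choice. *)
Definition L2_01 (R : realType) : Type :=
  LspaceType2 (uniform_prob (@ltr01 R)).

Definition normL2_sq (R : realType) (w : L2_01 R) : R :=
  \int[lebesgue_measure]_(z in `[0, 1]) (w z) ^+ 2.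

Definition moment (R : realType) (w : L2_01 R) (l : nat) : R :=
  \int[lebesgue_measure]_(z in `[0, 1]) (z ^+ l * w z).

Definition feasible (R : realType) (m : nat) (x : R) (w : L2_01 R) : Prop :=
  forall l : nat, (l < m)%N -> moment w l = x ^+ l.

Definition minimizer (R : realType) (m : nat) (x : R) (w : L2_01 R) : Prop :=
  feasible m x w /\
  forall v : L2_01 R, feasible m x v -> normL2_sq w <= normL2_sq v.

(* Indices start at 0, so that the entry 1/(i+j-1) becomes 1/(i+j+1). *)
Definition hilbert_mx (R : realType) (m : nat) : 'M[R]_m :=
  \matrix_(i < m, j < m) ((i + j).+1%:R)^-1.

Definition xbar (R : realType) (m : nat) (x : R) : 'cV[R]_m :=
  \col_(i < m) x ^+ i.

(* Main.v *)
(* In L^2([0,1]) the Hilbert matrix H is the Gram matrix of 1, z, ..., z^(m-1).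
   Hence H a = 0 forces the polynomial p with coefficients a to vanish almost
   everywhere, so that a = 0 and H is invertible.  If H a = xbar, then p is
   feasible, and every feasible v has the same inner product with p, namely
   the sum of the a_i x^i; so v - p is orthogonal to p and
   ||v||^2 = ||p||^2 + ||v - p||^2, which gives optimality and uniqueness. *)
Require Import Defs.
From mathcomp Require Import all_boot all_order all_algebra.
From mathcomp Require Import all_classical all_reals all_analysis.
From mathcomp Require Import measurable_realfun ring.
Set Implicit Arguments.
Unset Strict Implicit.
Unset Printing Implicit Defensive.
Import Order.TTheory GRing.Theory Num.Theory.
Import numFieldNormedType.Exports.
Local Open Scope classical_set_scope.
Local Open Scope ring_scope.

Section moment_problem.
Variable R : realType.
Local Notation mu := (@lebesgue_measure R).
Local Notation U := (uniform_prob (@ltr01 R)).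
Local Notation TR := (measurableTypeR R).
Local Notation I := (`[0%R, 1%R]%classic : set R).

(** * The uniform probability and Lebesgue measure on [0,1] *)

Lemma uniform_prob01E (A : set TR) :
  measurable A -> U A = mu (A `&` I).
Proof.
move=> mA; rewrite /uniform_prob integral_uniform_pdf.
rewrite (eq_integral (fun=> 1%E)); last first.
  move=> z /[!inE] -[_ /=]; rewrite in_itv/= /uniform_pdf => ->.
  by rewrite subr0 invr1.
by rewrite integral_cst ?mul1e//; exact: measurableI.
Qed.

(** The complement of [0,1] is null for [U], so adding it to an exceptional set costs nothing. *)
Lemma ae_uniform_prob01 (P : R -> Prop) :
  {ae U, forall z, P z} <-> {ae mu, forall z, z \in `[0, 1] -> P z}.
Proof.
split=> -[N [mN N0 subN]].
- exists (N `&` I); split; first exact: measurableI.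
    by rewrite -uniform_prob01E.
  by move=> z /= /not_implyP[zI nP]; split => //; exact: subN.
- exists (N `|` ~` I); split.
  + by apply: measurableU => //; apply: measurableC.
  + rewrite uniform_prob01E; last first.
      by apply: measurableU => //; apply: measurableC.
    rewrite setIUl setICl setU0; apply/eqP; rewrite -measure_le0 -N0.
    by apply: le_measure; rewrite ?inE//; exact: measurableI.
  + move=> z /= nP; have [zI|] := pselect (I z); [left|by right].
    by apply: subN => /= /(_ zI).
Qed.

Lemma integrable_uniform_prob01 (f : R -> R) :
  U.-integrable setT (EFin \o f) -> mu.-integrable I (EFin \o f).
Proof.
move=> /integrableP[mf foo]; apply/integrableP; split.
  exact: (measurable_funS measurableT).
move: foo; rewrite integral_uniform//; last exact: measurableT_comp.
by rewrite subr0 invr1 mul1e.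
Qed.

(** * Square-integrable functions and their classes *)

Lemma Lfun2_integrable_mul (f g : R -> R) :
  f \in Lfun U 2%:E -> g \in Lfun U 2%:E ->
  mu.-integrable I (EFin \o (f \* g)).
Proof.
move=> f2 g2; apply: integrable_uniform_prob01.
by apply/Lfun1_integrable; exact: Lfun2_mul_Lfun1.
Qed.

(** The square of [p] is again a polynomial, hence continuous and integrable on the compact
    segment. *)
Lemma horner_Lfun2 (p : {poly R}) : horner p \in Lfun U 2%:E.
Proof.
have mp : measurable_fun setT (horner p : R -> R).
  by apply: continuous_measurable_fun; exact: continuous_horner.
rewrite inE; apply/andP; split; rewrite inE//=.
rewrite /finite_norm unlock /Lnorm poweR_lty//.
rewrite integral_uniform//; first last.
- by move=> z; exact: poweR_ge0.
- apply: (measurableT_comp (measurable_poweR _)) => /=.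
  by apply/measurable_EFinP; exact: measurableT_comp.
rewrite subr0 invr1 mul1e.
have /integrableP[_] : mu.-integrable I (EFin \o horner (p ^+ 2)).
  apply: continuous_compact_integrable; first exact: segment_compact.
  by apply: continuous_subspaceT; exact: continuous_horner.
apply: le_lt_trans; rewrite le_eqVlt; apply/orP; left; apply/eqP.
by apply: eq_integral => z _/=; rewrite horner_exp normrX powR_mulrn.
Qed.

Lemma Lspace2_Lfun2 (w : L2_01 R) : (w : R -> R) \in Lfun U 2%:E.
Proof.
rewrite inE; apply/andP; split; rewrite inE//=.
- exact: (@measurable_funPT _ _ _ _ (repr (LebesgueSpace.sort w))).
- exact: Lebesgue_finite.
Qed.

(** The representative picked by the quotient agrees with [f] only almost everywhere, so finiteness
    of the norm has to be carried over to it. *)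
Lemma Lfun2_Lspace2 (f : R -> R) : f \in Lfun U 2%:E ->
  exists w : L2_01 R, {ae U, forall z, w z = f z}.
Proof.
move=> fL2.
have mf : f \in @mfun _ _ TR TR by exact: sub_Lfun_mfun fL2.
pose F : {mfun TR >-> TR} := @mfun_Sub _ _ TR TR f mf.
pose w0 : {mfun_ U, TR >-> TR} := (\pi F)%qT.
have w0F : {ae U, forall z, w0 z = f z}.
  have /eqquotP/asboolP : (repr w0 = F %[mod {mfun_ U, TR >-> TR}])%qT.
    by rewrite reprK.
  by apply: filterS => z; exact.
have w0fin : finite_norm U 2%:E w0.
  move: fL2; rewrite inE => /andP[_]; rewrite inE/= /finite_norm.
  rewrite unlock /Lnorm.
  suff -> : (\int[U]_x `|(EFin \o w0) x| `^ 2 =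
             \int[U]_x `|(EFin \o f) x| `^ 2)%E by [].
  apply: ge0_ae_eq_integral => //.
  - apply: (measurableT_comp (measurable_poweR _)) => /=.
    by apply/measurable_EFinP; exact: measurableT_comp.
  - apply: (measurableT_comp (measurable_poweR _)) => /=.
    by apply/measurable_EFinP; apply: measurableT_comp => //; exact/set_mem.
  - by move=> z _; exact: poweR_ge0.
  - by move=> z _; exact: poweR_ge0.
  - by apply: filterS w0F => z /= -> _.
exists (LebesgueSpace.Pack
  (LebesgueSpace.Class (isFinLebesgue.Build _ _ _ _ _ _ w0 w0fin))).
exact: w0F.
Qed.

Lemma Lspace2_ext (v w : L2_01 R) : {ae U, forall z, v z = w z} -> v = w.
Proof.
move=> vw.
have : LebesgueSpace.sort v = LebesgueSpace.sort w.
  rewrite -[LHS]reprK -[RHS]reprK; apply/eqquotP/asboolP.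
  by apply: filterS vw => z + _.
(* An element packs a class with a proof that its norm is finite; proof irrelevance identifies the
   two proofs. *)
case: v {vw} => v [[vf]]; case: w => w [[wf]] /= vw.
by subst w; rewrite (Prop_irrelevance vf wf).
Qed.

Lemma Lfun2B (f g : R -> R) :
  f \in Lfun U 2%:E -> g \in Lfun U 2%:E ->
  (fun z => f z - g z) \in Lfun U 2%:E.
Proof.
move=> f2 g2; rewrite (_ : (fun _ => _) = -1 *: g + f).
  by have [_ /(_ (-1) g f g2 f2)] := Lfun_submod_closed U (lee1n 2).
by apply/funext => z; rewrite scaleN1r addrC.
Qed.

Lemma exp_Lfun2 (l : nat) : (fun z : R => z ^+ l) \in Lfun U 2%:E.
Proof.
rewrite (_ : (fun _ => _) = horner 'X^l) ?horner_Lfun2//.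
by apply/funext => z; rewrite hornerXn.
Qed.

(** * Moments of polynomials and the Hilbert matrix *)

Lemma Rintegral_itv01_exp (n : nat) :
  \int[mu]_(z in `[0, 1]) z ^+ n = n.+1%:R^-1.
Proof.
pose F : {poly R} := n.+1%:R^-1 *: 'X^(n.+1).
rewrite /Rintegral (@continuous_FTC2 _ (fun z => z ^+ n) (horner F) 0 1)//=.
- by rewrite /F !hornerE expr1n expr0n/= mulr1 mulr0 subr0.
- by apply: continuous_subspaceT; exact: exprn_continuous.
- split.
  + by move=> z _; exact: derivable_horner.
  + by apply: cvg_at_right_filter; exact: continuous_horner.
  + by apply: cvg_at_left_filter; exact: continuous_horner.
- move=> z _; rewrite -derivE /F derivZ derivXn !hornerE.
  by rewrite hornerMn hornerXn -mulr_natl; field.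
Qed.

Lemma Rintegral_rVpoly_mul (m : nat) (a : 'rV[R]_m) (f : R -> R) :
  f \in Lfun U 2%:E ->
  \int[mu]_(z in `[0, 1]) ((rVpoly a).[z] * f z) =
  \sum_(i < m) a ord0 i * \int[mu]_(z in `[0, 1]) (z ^+ i * f z).
Proof.
move=> f2.
have intf (i : nat) (c : R) :
    mu.-integrable I (EFin \o (fun z => c * (z ^+ i * f z))).
  have mI : measurable (I : set TR) by exact: measurable_itv.
  exact: (integrableZl mI c (Lfun2_integrable_mul (exp_Lfun2 i) f2)).
transitivity (\int[mu]_(z in `[0, 1]) (\sum_(i < m) a ord0 i * (z ^+ i * f z))).
  apply: eq_Rintegral => z _.
  rewrite (@horner_coef_wide _ m) ?size_poly// mulr_suml.
  by apply: eq_bigr => i _; rewrite coef_rVpoly_ord mulrA.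
rewrite /Rintegral.
under eq_integral do rewrite -sumEFin.
rewrite integral_sum//; last by move=> i; exact: intf.
rewrite -sum_fine; last first.
  by move=> i _; apply: integrable_fin_num => //; exact: intf.
apply: eq_bigr => i _; apply: RintegralZl => //.
have := intf i 1; congr (mu.-integrable _ _).
by apply/funext => z; rewrite /= mul1r.
Qed.

(** The entry at (l, i) is the inner product of [z ^+ l] and [z ^+ i], so the system [H a = xbar]
    says that the polynomial with coefficients [a] is feasible. *)
Lemma hilbert_mx_moment (m : nat) (a : 'cV[R]_m) (l : 'I_m) :
  \int[mu]_(z in `[0, 1]) (z ^+ l * (rVpoly a^T).[z]) =
  (hilbert_mx R m *m a) l ord0.
Proof.
under eq_Rintegral do rewrite mulrC.
rewrite Rintegral_rVpoly_mul ?exp_Lfun2// mxE; apply: eq_bigr => i _.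
under eq_Rintegral do rewrite -exprD.
by rewrite Rintegral_itv01_exp !mxE mulrC addnC.
Qed.

(** * Squared norms and inner products *)

Lemma Rintegral_sqr_eq0 (f : R -> R) : f \in Lfun U 2%:E ->
  \int[mu]_(z in `[0, 1]) (f z) ^+ 2 = 0 -> {ae U, forall z, f z = 0}.
Proof.
move=> f2 f0; apply/ae_uniform_prob01.
have mf : measurable_fun (I : set TR) (EFin \o (fun z => f z ^+ 2)).
  by have /integrableP[] := Lfun2_integrable_mul f2 f2.
have /ae_eq_integral_abs :
    (\int[mu]_(z in I) `|(EFin \o (fun z => f z ^+ 2)%R) z| = 0)%E.
  under eq_integral do rewrite gee0_abs ?lee_fin ?sqr_ge0//.
  have ff := Lfun2_integrable_mul f2 f2.
  (* Since [fine] also sends infinities to 0, finiteness of the integral is what makes it vanish as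
     an extended real. *)
  rewrite -[LHS](fineK (integrable_fin_num _ ff))//.
  by congr EFin; exact: f0.
move=> /(_ (measurable_itv _) mf); apply: filterS => z fz zI.
by have [/eqP] := fz zI; rewrite sqrf_eq0 => /eqP.
Qed.

Lemma ae_eq_Rintegral_mul (f g h : R -> R) :
  f \in Lfun U 2%:E -> g \in Lfun U 2%:E -> h \in Lfun U 2%:E ->
  {ae U, forall z, f z = g z} ->
  \int[mu]_(z in `[0, 1]) (f z * h z) = \int[mu]_(z in `[0, 1]) (g z * h z).
Proof.
move=> f2 g2 h2 /ae_uniform_prob01 fg; congr fine.
apply: ae_eq_integral => //.
- by have /integrableP[] := Lfun2_integrable_mul f2 h2.
- by have /integrableP[] := Lfun2_integrable_mul g2 h2.
- (* The predicate lives on [R], not on its alias [TR]: the filter instance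
     is not inferred. *)
  apply: (@filterS _ _ (ae_filter_ringOfSetsType mu) _ _ _ fg) => z fgz zI.
  by rewrite (fgz zI).
Qed.

Lemma Rintegral_sqrB (f g : R -> R) :
  f \in Lfun U 2%:E -> g \in Lfun U 2%:E ->
  \int[mu]_(z in `[0, 1]) (f z - g z) ^+ 2 =
  \int[mu]_(z in `[0, 1]) (f z ^+ 2)
  - (\int[mu]_(z in `[0, 1]) (g z * f z)) *+ 2
  + \int[mu]_(z in `[0, 1]) (g z ^+ 2).
Proof.
move=> f2 g2.
have mI : measurable (I : set TR) by exact: measurable_itv.
have ff := Lfun2_integrable_mul f2 f2.
have gf := Lfun2_integrable_mul g2 f2.
have gg := Lfun2_integrable_mul g2 g2.
have fB2 := Lfun2B f2 g2.
have fBf := Lfun2_integrable_mul fB2 f2.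
have fBg := Lfun2_integrable_mul fB2 g2.
(* Every term is kept as a product of two square-integrable functions, so each splitting of the
   integral is justified. *)
transitivity (\int[mu]_(z in `[0, 1]) ((f z - g z) * f z - (f z - g z) * g z)).
  by apply: eq_Rintegral => z _; ring.
rewrite RintegralB//.
transitivity (\int[mu]_(z in `[0, 1]) (f z * f z - g z * f z)
              - \int[mu]_(z in `[0, 1]) (g z * f z - g z * g z)).
  by congr (_ - _); apply: eq_Rintegral => z _; ring.
rewrite !RintegralB//; under [in RHS]eq_Rintegral do rewrite expr2.
under [X in _ = _ + X]eq_Rintegral do rewrite expr2.
by ring.
Qed.

(** * Invertibility of the Hilbert matrix *)

Lemma ae_horner_eq0 (p : {poly R}) : {ae U, forall z, p.[z] = 0} -> p = 0.
Proof.
move=> p0; apply/eqP/negPn/negP => pN0.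
have fin : finite_set [set z | p.[z] = 0].
  (* An infinite root set would contain [size p] distinct roots, too many for a nonzero
     polynomial. *)
  apply: contrapT => /(@infinite_set_fset _ _ (size p))[B Bp].
  rewrite leqNgt => /negP; apply.
  apply: max_poly_roots pN0 _ (finmap.fset_uniq B).
  by apply/allP => z zB; apply/eqP; exact: Bp.
have pmu : {ae mu, forall z : R, p.[z] <> 0}.
  exists [set z | p.[z] = 0]; split.
  - by apply: countable_measurable => //; exact: finite_set_countable.
  - exact: countable_lebesgue_measure0 (finite_set_countable fin).
  - by move=> z /= /contrapT.
have pU : {ae U, forall z : R, p.[z] <> 0}.
  apply/ae_uniform_prob01.
  by apply: (@filterS _ _ (ae_filter_ringOfSetsType mu) _ _ _ pmu) => z + _.
(* Roots and non-roots would both have full measure; the whole line would then be null, against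
   total mass 1. *)
have [N [mN N0 subN]] : {ae U, forall z : TR, False}.
  by apply: (@filterS2 _ _ (ae_filter_ringOfSetsType U) _ _ _ _ p0 pU) => z.
have NT : N = setT by apply/seteqP; split => // z _; apply: subN => /=; exact.
by move: N0; rewrite NT probability_setT => /eqP; rewrite onee_eq0.
Qed.

(** By symmetry a left kernel vector [v] satisfies [H v^T = 0], and the squared norm of its
    polynomial is [v H v^T = 0]. *)
Lemma hilbert_mx_unit (m : nat) : hilbert_mx R m \in unitmx.
Proof.
rewrite -row_free_unit -kermx_eq0; apply/rowV0P => v /sub_kermxP vH.
have Hv : hilbert_mx R m *m v^T = 0.
  rewrite (_ : hilbert_mx R m = (hilbert_mx R m)^T) -?trmx_mul ?vH ?trmx0//.
  by apply/matrixP => i j; rewrite !mxE addnC.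
suff p0 : rVpoly v = 0 by rewrite -[v]rVpolyK p0 linear0.
apply/ae_horner_eq0/Rintegral_sqr_eq0; first exact: horner_Lfun2.
under eq_Rintegral do rewrite expr2.
rewrite Rintegral_rVpoly_mul ?horner_Lfun2// big1// => i _.
by rewrite -{2}[v]trmxK hilbert_mx_moment Hv mxE mulr0.
Qed.

End moment_problem.

(** * Existence, uniqueness and form of the minimizer *)

Theorem theorem2p1 (R : realType) (m : nat) (hm : (1 <= m)%N)
    (x : R) (hx : 0 <= x <= 1) :
  (exists! alpha : 'cV[R]_m, hilbert_mx R m *m alpha = xbar m x) /\
  (forall alpha : 'cV[R]_m, hilbert_mx R m *m alpha = xbar m x ->
     exists w : L2_01 R,
       {ae lebesgue_measure, forall z : R, z \in `]0, 1[ ->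
          w z = \sum_(i < m) alpha i ord0 * z ^+ i} /\
       unique (minimizer m x) w).
Proof.
have Hunit := hilbert_mx_unit R m.
split.
  exists (invmx (hilbert_mx R m) *m xbar m x); split; first by rewrite mulKVmx.
  by move=> a <-; rewrite mulKmx.
move=> a Ha; set p := rVpoly a^T.
have pE z : p.[z] = \sum_(i < m) a i ord0 * z ^+ i.
  rewrite (@horner_coef_wide _ m) ?size_poly//.
  by apply: eq_bigr => i _; rewrite coef_rVpoly_ord mxE.
have p2 : horner p \in Lfun (uniform_prob (@ltr01 R)) 2%:E := horner_Lfun2 p.
have [w wp] := Lfun2_Lspace2 p2.
exists w; split.
  move/ae_uniform_prob01 : wp.
  apply: (@filterS _ _ (ae_filter_ringOfSetsType _)) => z wpz z01.
  by rewrite wpz ?pE//; exact: subset_itv_oo_cc.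
have L2 (v : L2_01 R) : (v : R -> R) \in Lfun (uniform_prob (@ltr01 R)) 2%:E.
  exact: Lspace2_Lfun2.
have feas_w : feasible m x w.
  move=> l lm; rewrite /moment.
  (* The factor [w] is moved to the front to be replaced by [p], which agrees with it almost
     everywhere. *)
  under eq_Rintegral do rewrite mulrC.
  rewrite (ae_eq_Rintegral_mul (L2 w) p2 (exp_Lfun2 R l) wp).
  under eq_Rintegral do rewrite mulrC.
  by rewrite (hilbert_mx_moment a (Ordinal lm)) Ha mxE.
have inner v : feasible m x v ->
    \int[lebesgue_measure]_(z in `[0, 1]) (w z * v z) =
    \sum_(i < m) a i ord0 * x ^+ i.
  move=> fv; rewrite (ae_eq_Rintegral_mul (L2 w) p2 (L2 v) wp).
  rewrite Rintegral_rVpoly_mul//; apply: eq_bigr => i _.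
  by rewrite mxE; congr (_ * _); exact: fv.
have normw : normL2_sq w = \sum_(i < m) a i ord0 * x ^+ i.
  by rewrite -(inner w feas_w); apply: eq_Rintegral => z _; rewrite expr2.
(* The cross term equals the squared norm of [w]: both are the sum of the [a i ord0 * x ^+ i]. *)
have pythagoras v : feasible m x v ->
    \int[lebesgue_measure]_(z in `[0, 1]) (v z - w z) ^+ 2 =
    normL2_sq v - normL2_sq w.
  move=> fv; rewrite Rintegral_sqrB// inner// -normw.
  by rewrite -/(normL2_sq w) -/(normL2_sq v); ring.
split; first split => // v fv.
  rewrite -subr_ge0 -pythagoras//.
  by apply: Rintegral_ge0 => z _; exact: sqr_ge0.
move=> v [fv vmin]; apply/esym/Lspace2_ext.
have vw0 : \int[lebesgue_measure]_(z in `[0, 1]) (v z - w z) ^+ 2 = 0.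
  apply/eqP; rewrite eq_le Rintegral_ge0 ?andbT//; last first.
    by move=> z _; exact: sqr_ge0.
  (* Minimality of [v] against the feasible [w] bounds the squared distance by 0. *)
  by rewrite pythagoras// subr_le0 vmin.
have := Rintegral_sqr_eq0 (Lfun2B (L2 v) (L2 w)) vw0.
apply: (@filterS _ _ (ae_filter_ringOfSetsType _)) => z /eqP.
by rewrite subr_eq0 => /eqP.
Qed.
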